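(* Consider the Erlang-C system. For all integers $n\ge1$ and all $\lambda>0$, $\mu>0$ satisfying $1\le R<n$, $$d_K(\tilde X(\infty),Y(\infty))\le 156\,\delta .$$
   Context: Erlang-C system: $n$ homogeneous servers, Poisson arrivals with rate $\lambda$, i.i.d. exponential service times with mean $1/\mu$, first-come-first-serve, infinite buffer, no abandonment. The customer count $X=\{X(t),t\ge 0\}$ is the birth-death process on $\{0,1,2,\dots\}$ with birth rate $\lambda$ in every state and death rate $\mu(k\wedge n)$ in state $k$. Set $R=\lambda/\mu$ and $\delta=1/\sqrt R$; when $R<n$, $X$ is positive recurrent and $X(\infty)$ denotes a random variable with its stationary distribution. Set $\tilde X(\infty)=\delta(X(\infty)-R)$ and $\zeta=\delta(R-n)$. With $x^-=\max(-x,0)$, let $b(x)=\big((x+\zeta)^--\zeta^-\big)\mu$. $Y(\infty)$ is a continuous random variable on $\mathbb{R}$ with density $\kappa\exp\big(\frac1\mu\int_0^xb(y)\,dy\big)$, $\kappa>0$ the normalizing constant. The Kolmogorov distance is $d_K(U,V)=\sup_{a\in\mathbb{R}}|\mathbb{P}(U\le a)-\mathbb{P}(V\le a)|$. *)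

(* Defs.v *)
From HB Require Import structures.
From mathcomp Require Import all_boot all_order all_algebra.
From mathcomp Require Import all_classical all_reals all_analysis.
Set Implicit Arguments.
Unset Strict Implicit.
Unset Printing Implicit Defensive.
Import Order.TTheory GRing.Theory Num.Theory.
Import numFieldNormedType.Exports.
Local Open Scope classical_set_scope.
Local Open Scope ring_scope.

(* [p t i j] is the probability of being in state [j] at time [t] when started
   from state [i]; only times [t >= 0] are constrained. *)
Record transition_function (R : realType) (p : R -> nat -> nat -> R) : Prop :=
  TransitionFunction {
    tf_ge0 : forall (t : R) i j, 0 <= t -> 0 <= p t i j;
    tf_sum1 : forall (t : R) i, 0 <= t -> (\sum_(0 <= j <oo) (p t i j)%:E = 1)%E;
    tf_0 : forall i j, p 0 i j = (i == j)%:R;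
    tf_chapman_kolmogorov : forall (s t : R) i j, 0 <= s -> 0 <= t ->
      ((p (s + t) i j)%:E = \sum_(0 <= k <oo) (p s i k * p t k j)%:E)%E }.

(* [p h i j = (i == j) + q i j * h + o(h)] as [h] decreases to 0. *)
Definition has_transition_rates (R : realType) (p : R -> nat -> nat -> R)
    (q : nat -> nat -> R) : Prop :=
  forall i j, (p h i j - (i == j)%:R) / h @[h --> 0^'+] --> q i j.

Definition birth_death_rate (R : realType) (birth death : nat -> R)
    (i j : nat) : R :=
  if j == i.+1 then birth i
  else if i == j.+1 then death i
  else if i == j then - (birth i + (if i == 0%N then 0 else death i))
  else 0.

Definition stationary_distribution (R : realType) (p : R -> nat -> nat -> R)
    (pi : probability nat R) : Prop :=
  forall (t : R) j, 0 <= t ->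
    (\sum_(0 <= i <oo) pi [set i] * (p t i j)%:E = pi [set j])%E.

Definition erlangC_rate (R : realType) (n : nat) (lambda mu : R) :
    nat -> nat -> R :=
  birth_death_rate (fun=> lambda) (fun k => mu * (minn k n)%:R).

Definition erlangC_transition (R : realType) (n : nat) (lambda mu : R)
    (p : R -> nat -> nat -> R) : Prop :=
  transition_function p /\ has_transition_rates p (erlangC_rate n lambda mu).

(* [load lambda mu] is the offered load, written R in queueing theory. *)
Definition load (R : realType) (lambda mu : R) : R := lambda / mu.

Definition delta (R : realType) (lambda mu : R) : R :=
  1 / Num.sqrt (load lambda mu).

Definition zeta (R : realType) (n : nat) (lambda mu : R) : R :=
  delta lambda mu * (load lambda mu - n%:R).

Definition scaled (R : realType) (lambda mu : R) d (T : measurableType d)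
    (X : T -> nat) : T -> R :=
  fun w => delta lambda mu * ((X w)%:R - load lambda mu).

Section scaled_mfun.
Context (R : realType) (lambda mu : R) d (T : measurableType d)
  (X : {mfun T >-> nat}).

Let measurable_scaled : measurable_fun [set: T] (scaled lambda mu X).
Proof.
exact: (@measurableT_comp _ _ _ _ _ _
  (fun k : nat => delta lambda mu * (k%:R - load lambda mu))).
Qed.

HB.instance Definition _ :=
  isMeasurableFun.Build _ _ _ _ (scaled lambda mu X) measurable_scaled.
End scaled_mfun.

Definition neg_part (R : realType) (x : R) : R := Num.max (- x) 0.

Definition drift (R : realType) (n : nat) (lambda mu : R) (x : R) : R :=
  (neg_part (x + zeta n lambda mu) - neg_part (zeta n lambda mu)) * mu.

(* The oriented integral of [f] from 0 to [x]. *)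
Definition integral_from0 (R : realType) (f : R -> R) (x : R) : R :=
  if 0 <= x then \int[lebesgue_measure]_(y in `[0, x]) f y
  else - \int[lebesgue_measure]_(y in `[x, 0]) f y.

Definition diffusion_density (R : realType) (n : nat) (lambda mu kappa : R)
    (x : R) : R :=
  kappa * expR (1 / mu * integral_from0 (drift n lambda mu) x).

Definition has_density (R : realType) d (T : measurableType d)
    (P : probability T R) (Y : {RV P >-> R}) (f : R -> R) : Prop :=
  forall A : set R, measurable A ->
    distribution P Y A = (\int[lebesgue_measure]_(x in A) (f x)%:E)%E.

(* An extended-real supremum, so that no boundedness side condition is
   needed. *)
Definition kolmogorov_distance (R : realType)
    d (T : measurableType d) (P : probability T R) (U : {RV P >-> R})
    d' (T' : measurableType d') (P' : probability T' R) (V : {RV P' >-> R}) :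
    \bar R :=
  ereal_sup [set `|cdf U a - cdf V a|%E | a in [set: R]].

(* Main.v *)
Require Import Defs.
From mathcomp Require Import all_boot all_order all_algebra.
From mathcomp Require Import all_classical all_reals all_analysis.
From mathcomp Require Import measurable_realfun ring lra zify.
Import Order.TTheory GRing.Theory Num.Theory.
Import numFieldNormedType.Exports.
Local Open Scope classical_set_scope.
Local Open Scope ring_scope.

(** The proof is Stein's method for the diffusion, tested against the stationary
    distribution of the chain.

    Write [r] for the load, [dl] for [delta], [z = - zeta > 0], and let [a k] be
    the stationary probability of [k]. In the scaled variable the drift of the
    diffusion, divided by [mu], is [nu x = - min(x, z)], and the drift of the
    chain at the grid point [dl * (k - r)] is the same function:
    [nu (dl * (k - r)) = dl * (r - min(k, n))].

    Stationarity for the transition function is first turned into the detailed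
    balance [r * a k = min(k + 1, n) * a (k + 1)]
    ([erlangC_stationary_balance]), equivalently into the identity
    [E (r g(X + 1) - min(X, n) g(X)) = 0] for test functions [g]
    ([stein_identity]). Particular choices of [g] show that [nu] at the scaled
    count has absolute mean at most [1] ([mean_abs_imbalance]) and that no state
    has probability above [dl] ([mass_le_delta]).

    The density [p] of the diffusion satisfies [p' = nu p]. For a point [x0], the
    Stein equation [f' + nu f = 1_(x <= x0) - F x0] is solved by
    [(1 - F x0) F / p] on the left of [x0] and [F x0 (1 - F) / p] on the right.
    Bounds of Mills ratio type give [|nu f| <= 1], hence [|f'| <= 2], and
    [f <= 4] on the left of [z] ([stein_drift_bound], [stein_bound]). On the
    right of [z], where [f] may be as large as [1 / z], the drift is constant and
    [f] contributes to the error through [f'] only. When [x0] is a grid point, both the jump of the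
    indicator and the kink of [nu] are grid points, so that [f] is smooth between
    neighbouring ones and the generator of the chain, applied to [f], agrees with
    the Stein operator up to [dl * (4 + 2 |nu|)] ([stein_step]). Taking
    expectations bounds the difference of the two distribution functions at grid
    points by [6 * dl] ([grid_bound]), and monotonicity costs one more [dl]
    elsewhere ([between_grid_bound]). *)

Set Implicit Arguments.
Unset Strict Implicit.
Unset Printing Implicit Defensive.

(** * Series of nonnegative reals and laws on the natural numbers *)

Lemma psum_le_nneseries (R : realType) (u : nat -> R) (l : R) N :
  (forall i, 0 <= u i) -> (\sum_(0 <= i <oo) (u i)%:E = l%:E)%E ->
  \sum_(i < N) u i <= l.
Proof.
move=> u_ge0 ul; rewrite -lee_fin -ul -sumEFin.
rewrite -(big_mkord xpredT (fun i => (u i)%:E)).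
by apply: nneseries_lim_ge => i _ _; rewrite lee_fin.
Qed.

Lemma term_le_nneseries (R : realType) (u : nat -> R) (l : R) k :
  (forall i, 0 <= u i) -> (\sum_(0 <= i <oo) (u i)%:E = l%:E)%E -> u k <= l.
Proof.
move=> u_ge0 ul; apply: le_trans (psum_le_nneseries k.+1 u_ge0 ul).
by rewrite big_ord_recr/= lerDr sumr_ge0.
Qed.

Lemma cvg_psum (R : realType) (u : nat -> R) (l : R) :
  (forall i, 0 <= u i) -> (\sum_(0 <= i <oo) (u i)%:E = l%:E)%E ->
  \sum_(i < N) u i @[N --> \oo] --> l.
Proof.
move=> u_ge0 ul.
suff : (\sum_(i < N) u i)%:E @[N --> \oo] --> l%:E by exact: fine_cvg.
rewrite -ul.
under eq_fun do rewrite -sumEFin -(big_mkord xpredT (fun i => (u i)%:E)).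
by apply: is_cvg_nneseries => i _ _; rewrite lee_fin.
Qed.

Section law_on_nat.
Context (R : realType) (m : probability nat R).

Lemma mass_series : (\sum_(0 <= i <oo) (fine (m [set i]))%:E = 1)%E.
Proof.
rewrite -(probability_setT m).
have -> : [set: nat] = \bigcup_i [set i] by apply/seteqP; split => // x _; exists x.
rewrite measure_bigcup//; last first.
  by apply/trivIsetP => i j _ _ /eqP ij; rewrite -subset0 => x [-> /ij].
rewrite [RHS](eq_eseriesl (Q := xpredT)); last by move=> i; rewrite in_setT.
by apply: eq_eseriesr => i _; rewrite fineK ?fin_num_measure//.
Qed.

Lemma mass_below N :
  m [set k | (k < N)%N] = (\sum_(i < N) fine (m [set (i : nat)]))%:E.
Proof.
elim: N => [|N ih].
  rewrite big_ord0 (_ : [set k | _] = set0) ?measure0//.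
  by apply/seteqP; split.
have -> : [set k | (k < N.+1)%N] = [set k | (k < N)%N] `|` [set N].
  apply/seteqP; split => k /=; last by case=> [/ltnW|->].
  by rewrite ltnS (leq_eqVlt k N) => /predU1P[->|]; [right|left].
rewrite [LHS](_ : _ = m [set k | (k < N)%N] + m [set N])%E.
  by rewrite ih big_ord_recr/= EFinD fineK// fin_num_measure.
apply: measureU => //; rewrite -subset0 => k /= [] /[swap] ->.
by rewrite ltnn.
Qed.

End law_on_nat.

(** * From stationarity to detailed balance *)

Section transition.
Context (R : realType) (p : R -> nat -> nat -> R).
Hypothesis tf : transition_function p.

Lemma transition_off_diag (t : R) i j : 0 <= t -> i != j -> p t i j <= 1 - p t i i.
Proof.
move=> t0 ij; have p0 k := tf_ge0 tf i k t0.
have := psum_le_nneseries (maxn i j).+1 p0 (tf_sum1 tf i t0).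
have li : (i < (maxn i j).+1)%N by lia.
have lj : (j < (maxn i j).+1)%N by lia.
rewrite (bigD1 (Ordinal li))// (bigD1 (Ordinal lj))/=; last first.
  by rewrite -val_eqE/= eq_sym.
have : 0 <= \sum_(k < (maxn i j).+1 |
    (k != Ordinal li) && (k != Ordinal lj)) p t i k by exact: sumr_ge0.
lra.
Qed.

Lemma transition_diag_le1 (t : R) i : 0 <= t -> p t i i <= 1.
Proof.
move=> t0; apply: (term_le_nneseries _ _ (tf_sum1 tf i t0)) => k.
exact: tf_ge0.
Qed.

(** Staying in [i] throughout two consecutive periods is one way of being back
    in [i] at the end, so [p s i i * p t i i <= p (s + t) i i]. *)
Lemma exit_subadditive (s t : R) i : 0 <= s -> 0 <= t ->
  1 - p (s + t) i i <= (1 - p s i i) + (1 - p t i i).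
Proof.
move=> s0 t0.
have : p s i i * p t i i <= p (s + t) i i.
  have := tf_chapman_kolmogorov tf i i s0 t0 => /esym.
  move/(@term_le_nneseries _ (fun k => p s i k * p t k i)); apply=> k.
  by rewrite mulr_ge0// tf_ge0.
have := transition_diag_le1 i s0; have := transition_diag_le1 i t0.
nra.
Qed.

Lemma exit_mulrn (t : R) i m : 0 <= t ->
  1 - p (t *+ m) i i <= (1 - p t i i) *+ m.
Proof.
move=> t0; elim: m => [|m ih]; first by rewrite !mulr0n (tf_0 tf) eqxx subrr.
rewrite !mulrSr; have := exit_subadditive i (mulrn_wge0 m t0) t0; lra.
Qed.

(** Subadditivity upgrades the derivative at [0] to a bound at all times: cut
    [t] into steps so short that the derivative controls each of them. *)
Lemma exit_le q (C t : R) i : has_transition_rates p q -> - q i i < C -> 0 <= t ->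
  1 - p t i i <= C * t.
Proof.
move=> pq qC; rewrite le_eqVlt => /predU1P[<-|t0].
  by rewrite (tf_0 tf) eqxx mulr0 subrr.
have [e /= e0 He] : \forall h \near 0^'+, - C < (p h i i - (i == i)%:R) / h.
  by apply: (cvgr_gt _ (pq i i)); rewrite ltrNl.
have [m tm] : exists m : nat, t / m.+1%:R < e.
  exists (Num.bound (t / e)).
  rewrite ltr_pdivrMr// mulrC -ltr_pdivrMr//.
  have := archi_boundP (divr_ge0 (ltW t0) (ltW e0)).
  by move=> /lt_le_trans; apply; rewrite ler_nat.
have h0 : 0 < t / m.+1%:R by rewrite divr_gt0.
have := He (t / m.+1%:R); rewrite /= sub0r normrN gtr0_norm// => /(_ tm h0).
rewrite eqxx mulr1n ltr_pdivlMr// => H.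
have := exit_mulrn i m.+1 (ltW h0).
rewrite -[t / _ *+ _]mulr_natr divfK// => /le_trans; apply.
rewrite -[leLHS]mulr_natr -ler_pdivlMr// -mulrA; move: (t / _) H => h; lra.
Qed.

End transition.

(** Differentiating [\sum_i a i * p t i j = a j] at [t = 0] needs the limit to be
    exchanged with the infinite sum. Uniformly bounded exit rates allow it: for
    [i != j], [p t i j / t <= (1 - p t i i) / t <= C], so that the terms beyond
    [N] contribute at most [C] times the tail of [a]. *)
Lemma stationary_balance (R : realType) (p : R -> nat -> nat -> R)
    (q : nat -> nat -> R) (a : nat -> R) (C : R) (j N0 : nat) :
  transition_function p -> has_transition_rates p q ->
  (forall i, 0 <= a i) -> (\sum_(0 <= i <oo) (a i)%:E = 1)%E ->
  (forall t, 0 <= t -> (\sum_(0 <= i <oo) (a i * p t i j)%:E = (a j)%:E)%E) ->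
  (forall i, - q i i < C) -> (j < N0)%N -> (forall i, (N0 <= i)%N -> q i j = 0) ->
  \sum_(i < N0) a i * q i j = 0.
Proof.
move=> tf pq a0 a1 st qC jN0 q0.
have a1N := cvg_psum a0 a1.
have key N : (N0 <= N)%N ->
    `|\sum_(i < N0) a i * q i j| <= C * (1 - \sum_(i < N) a i).
  move=> N0N.
  have -> : \sum_(i < N0) a i * q i j = \sum_(i < N) a i * q i j.
    rewrite (big_ord_widen N (fun i => a i * q i j) N0N).
    rewrite [RHS](bigID (fun i : 'I_N => (i < N0)%N))/=.
    rewrite [X in _ = _ + X]big1 ?addr0// => i; rewrite -leqNgt => Ni.
    by rewrite q0 ?mulr0.
  have jN : (j < N)%N by exact: leq_trans N0N.
  pose g t := (\sum_(i < N) a i * p t i j - a j) / t.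
  have gE t : g t = \sum_(i < N) a i * ((p t i j - (i == j :> nat)%:R) / t).
    rewrite /g; under [RHS]eq_bigr do rewrite mulrA mulrBr.
    rewrite -mulr_suml sumrB; congr ((_ - _) / _).
    rewrite (bigD1 (Ordinal jN))//= eqxx mulr1 big1 ?addr0// => i.
    by rewrite -val_eqE/= => /negPf ->; rewrite mulr0.
  have gcvg : g t @[t --> 0^'+] --> \sum_(i < N) a i * q i j.
    rewrite (funext gE).
    apply: cvg_big => [|i _]; first exact: add_continuous.
    apply: cvgMl_tmp.
    exact: pq.
  have gbnd : \forall t \near 0^'+, `|g t| <= C * (1 - \sum_(i < N) a i).
    near=> t.
    have t0 : 0 < t by [].
    have pt0 i : 0 <= a i * p t i j by rewrite mulr_ge0// (tf_ge0 tf)// ltW.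
    rewrite /g normrM normfV (gtr0_norm t0) ler_pdivrMr// distrC.
    rewrite ger0_norm; last first.
      by rewrite subr_ge0; exact: (psum_le_nneseries N pt0 (st _ (ltW t0))).
    (* Pass to the limit in the length [M] of the sum between [N] and [M]. *)
    have cvg1 := cvg_psum pt0 (st _ (ltW t0)).
    have lhs : \sum_(i < M) a i * p t i j - \sum_(i < N) a i * p t i j @[M --> \oo]
        --> a j - \sum_(i < N) a i * p t i j.
      by apply: cvgB => //; exact: cvg_cst.
    have rhs : C * t * (\sum_(i < M) a i - \sum_(i < N) a i) @[M --> \oo]
        --> C * t * (1 - \sum_(i < N) a i).
      by apply: cvgMl_tmp; apply: cvgB => //; exact: cvg_cst.
    rewrite mulrAC; apply: (ler_cvg_to lhs rhs).
    near=> M.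
    have NM : (N <= M)%N by near: M; exact: nbhs_infty_ge.
    rewrite -!(big_mkord xpredT (fun i => a i * p t i j)) -!(big_mkord xpredT a).
    rewrite !(big_cat_nat (leq0n N) NM)/= !(addrC (\sum_(0 <= i < N) _)).
    rewrite !addrK mulr_sumr.
    rewrite big_nat [leRHS]big_nat; apply: ler_sum => i /andP[Ni _].
    rewrite mulrC ler_wpM2r//.
    apply: (le_trans (transition_off_diag tf (ltW t0) _)).
      by apply/eqP => ij; move: Ni; rewrite ij leqNgt jN.
    exact: (exit_le tf pq (qC i) (ltW t0)).
  apply: (ler_cvg_to (cvg_norm gcvg) (cvg_cst _) gbnd).
apply/normr0_eq0/le_anti; rewrite normr_ge0 andbT.
have lim0 : C * (1 - \sum_(i < N) a i) @[N --> \oo] --> C * (1 - 1).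
  by apply: cvgMl_tmp; apply: cvgB => //; exact: cvg_cst.
rewrite subrr mulr0 in lim0.
apply: (ler_cvg_to (cvg_cst _) lim0).
by near=> N; apply: key; near: N; exact: nbhs_infty_ge.
Unshelve. all: by end_near. Qed.

(** The balance equation of state [j] says that the net flows from [j - 1] to [j]
    and from [j] to [j + 1] agree; there is no flow into [0] from below, so all
    of them vanish. *)
Lemma birth_death_detailed_balance (R : realType) (b dth a : nat -> R) :
  (forall j, \sum_(i < j.+2) a i * birth_death_rate b dth i j = 0) ->
  forall k, b k * a k = dth k.+1 * a k.+1.
Proof.
move=> bal; elim=> [|k ih].
  have := bal 0%N; rewrite !big_ord_recr big_ord0/= /birth_death_rate/=; lra.
have := bal k.+1; rewrite !big_ord_recr/= big1; last first.
  move=> i _; rewrite /birth_death_rate eqSS.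
  have ik := ltn_ord i.
  by rewrite !ifF ?mulr0//; lia.
have e12 : (k.+1 == k.+2) = false by lia.
have e13 : (k.+1 == k.+3) = false by lia.
rewrite /birth_death_rate !eqxx e12 e13 /=; lra.
Qed.

Lemma erlangC_stationary_balance (R : realType) (n : nat) (lambda mu : R)
    (p : R -> nat -> nat -> R) (m : probability nat R) (k : nat) :
  0 < lambda -> 0 < mu -> erlangC_transition n lambda mu p ->
  stationary_distribution p m ->
  load lambda mu * fine (m [set k]) = (minn k.+1 n)%:R * fine (m [set k.+1]).
Proof.
move=> lambda0 mu0 [tf rates] stat; pose a i := fine (m [set i]).
have mE i : m [set i] = (a i)%:E by rewrite fineK// fin_num_measure.
have a_ge0 i : 0 <= a i by exact: fine_ge0.
have bal j : \sum_(i < j.+2) a i * erlangC_rate n lambda mu i j = 0.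
  apply: (stationary_balance (C := lambda + mu * n%:R + 1)
    tf rates a_ge0 (mass_series m)) => //.
  - move=> t t0; rewrite -mE -(stat t j t0).
    by apply: eq_eseriesr => i _; rewrite mE EFinM.
  - move=> i; rewrite /erlangC_rate /birth_death_rate eqxx.
    have -> : (i == i.+1) = false by lia.
    rewrite opprK ltr_pwDr// lerD2l; case: ifP => _; first by rewrite mulr_ge0// ltW.
    by rewrite ler_wpM2l ?(ltW mu0)// ler_nat geq_minr.
  - move=> i ji; rewrite /erlangC_rate /birth_death_rate.
    have -> : (j == i.+1) = false by lia.
    have -> : (i == j.+1) = false by lia.
    by have -> : (i == j) = false by lia.
have := birth_death_detailed_balance bal k.
rewrite /load -/(a k) -/(a k.+1) => H.
apply: (mulfI (lt0r_neq0 mu0)); rewrite !mulrA -H.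
by field; rewrite lt0r_neq0.
Qed.

(** * Consequences of detailed balance for the Erlang-C rates *)

Section detailed_balance.
Context (R : realType) (n : nat) (r : R) (a : nat -> R).
Hypothesis a_ge0 : forall k, 0 <= a k.
Hypothesis a_balance : forall k, r * a k = (minn k.+1 n)%:R * a k.+1.

(** The discrete Stein identity [E (r g(X + 1) - min(X, n) g(X)) = 0], truncated
    at [K]: detailed balance makes the sum telescope, leaving a boundary term. *)
Lemma stein_identity (g : nat -> R) K :
  \sum_(k < K) a k * (r * g k.+1 - (minn k n)%:R * g k)
  = (minn K n)%:R * a K * g K.
Proof.
elim: K => [|K ih]; first by rewrite big_ord0 min0n !mul0r.
by rewrite big_ord_recr/= ih -a_balance; ring.
Qed.

Hypothesis r_gt0 : 0 < r.
Hypothesis r_ltn : r < n%:R.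
Hypothesis a_psum : forall K, \sum_(k < K) a k <= 1.

Lemma mean_imbalance K :
  \sum_(k < K) a k * (r - (minn k n)%:R) = (minn K n)%:R * a K.
Proof.
rewrite -[RHS]mulr1 -(stein_identity (fun=> 1)).
by apply: eq_bigr => k _; rewrite !mulr1.
Qed.

(** Taking [g k = min(k, n)] in the Stein identity gives
    [E (r - min(X, n))^2 = r * E (min(X + 1, n) - min(X, n)) <= r]. *)
Lemma var_imbalance K : \sum_(k < K) a k * (r - (minn k n)%:R) ^+ 2 <= r.
Proof.
(* From [n] on, the boundary term of the truncated identity has a favourable
   sign; shorter sums only drop nonnegative terms. *)
wlog nK : K / (n <= K)%N => [H|].
  apply: le_trans (H (K + n)%N (leq_addl _ _)).
  rewrite big_split_ord/= lerDl sumr_ge0// => i _.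
  by rewrite mulr_ge0// sqr_ge0.
pose s k : R := (minn k n)%:R.
have H k : a k * (r - s k) ^+ 2 <=
    r * (a k * (r - s k)) - a k * (r * s k.+1 - s k * s k) + r * a k.
  have : s k.+1 <= s k + 1 by rewrite /s natr1 ler_nat; lia.
  move=> /(ler_wpM2l (mulr_ge0 (a_ge0 k) (ltW r_gt0))); lra.
apply: le_trans (ler_sum _ (fun (k : 'I_K) _ => H k)) _.
rewrite big_split/= sumrB -!mulr_sumr mean_imbalance (stein_identity s).
have -> : s K = n%:R by rewrite /s; congr _%:R; lia.
rewrite (minn_idPr nK).
have : n%:R * a K * (n%:R - r) >= 0.
  by rewrite !mulr_ge0// subr_ge0 ltW.
have := ler_wpM2l (ltW r_gt0) (a_psum K); lra.
Qed.

Context (dl : R).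
Hypothesis dl_gt0 : 0 < dl.
Hypothesis dl_sq : dl ^+ 2 * r = 1.
Local Notation nu k := (dl * (r - (minn k n)%:R)).

(** The scaling [dl ^+ 2 * r = 1] makes the variance bound equal to [1], and
    [|y| <= (y^2 + 1) / 2] passes from it to the absolute mean. *)
Lemma mean_abs_imbalance K : \sum_(k < K) a k * `|nu k| <= 1.
Proof.
have H k : a k * `|nu k| <=
    dl ^+ 2 / 2 * (a k * (r - (minn k n)%:R) ^+ 2) + 1 / 2 * a k.
  have : `|nu k| <= (`|nu k| ^+ 2 + 1) / 2 by have := sqr_ge0 (`|nu k| - 1); lra.
  rewrite real_normK ?num_real// exprMn.
  by move=> /(ler_wpM2l (a_ge0 k)); lra.
apply: le_trans (ler_sum _ (fun (k : 'I_K) _ => H k)) _.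
rewrite big_split/= -!mulr_sumr.
have := var_imbalance K; have := a_psum K.
have := sqr_ge0 dl; move: (\sum_(k < K) _) (\sum_(k < K) _) => x y dl0 x1 yr.
have := ler_wpM2l dl0 yr; rewrite dl_sq; lra.
Qed.

(** Truncated just after [k], the mean imbalance reduces to its boundary term
    [r * a k], while it cannot exceed the mean absolute imbalance. *)
Lemma mass_le_delta k : a k <= dl.
Proof.
have : dl * (r * a k) <= 1.
  rewrite a_balance -mean_imbalance mulr_sumr.
  apply: le_trans (mean_abs_imbalance k.+1).
  apply: ler_sum => i _.
  by rewrite mulrCA ler_wpM2l// ler_norm.
move=> /(ler_wpM2l (ltW dl_gt0)).
have -> : dl * (dl * (r * a k)) = (dl ^+ 2 * r) * a k by ring.
by rewrite dl_sq mul1r mulr1.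
Qed.

End detailed_balance.

(** * The Stein equation of the diffusion *)

Section calculus.
Context (R : realType).

Lemma mean_value (f df : R -> R) (a b : R) : a < b ->
  (forall x : R, is_derive x 1 f (df x)) ->
  exists c, [/\ a < c, c < b & f b - f a = df c * (b - a)].
Proof.
move=> ab dfx.
have [|c] := MVT ab (fun x _ => dfx x).
  by apply: derivable_within_continuous => x _; exact: ex_derive.
by rewrite in_itv/= => /andP[ac cb] ?; exists c.
Qed.

Lemma ge0_derive_le (f df : R -> R) (a b : R) : a <= b ->
  (forall x : R, is_derive x 1 f (df x)) ->
  (forall x, a < x -> x < b -> 0 <= df x) -> f a <= f b.
Proof.
rewrite le_eqVlt => /predU1P[->//|ab] dfx df0.
have [c [ac cb fab]] := mean_value ab dfx.
by rewrite -subr_ge0 fab mulr_ge0 ?df0// subr_ge0 ltW.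
Qed.

End calculus.

Section stein.
Context (R : realType) (z : R) (F p : R -> R).
Local Notation nu x := (- Num.min x z).
Hypothesis z_gt0 : 0 < z.
Hypothesis p_gt0 : forall x, 0 < p x.
Hypothesis dF : forall x : R, is_derive x 1 F (p x).
Hypothesis dp : forall x : R, is_derive x 1 p (nu x * p x).
Hypothesis F_ge0 : forall x, 0 <= F x.
Hypothesis F_le1 : forall x, F x <= 1.
Hypothesis F_pinfty : F x @[x --> +oo] --> (1 : R).
Hypothesis F_ninfty : F x @[x --> -oo] --> (0 : R).

Let le_min (x y : R) : x <= y -> Num.min x z <= Num.min y z.
Proof. by case: (leP x z); case: (leP y z); lra. Qed.

Let dpF (c x : R) : is_derive x 1 (p + c \*: F) ((nu x + c) * p x).
Proof. by apply: is_derive_eq; rewrite mulrDl. Qed.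

(** With [c = - nu x], the function [p + c F] is nonincreasing to the right of
    [x], because [(p + c F)' = (nu + c) p] and [nu] is nonincreasing; its limit
    inferior at [+oo] is at least [c]. *)
Lemma mills_right (x : R) : 0 <= x -> - nu x * (1 - F x) <= p x.
Proof.
move=> x0; set c := - nu x.
have c0 : 0 <= c by rewrite /c opprK; case: (leP x z) z_gt0; lra.
rewrite mulrBr lerBlDr.
have lim : c * F y @[y --> +oo] --> c * 1 by apply: cvgMl_tmp.
apply: (ler_cvg_to lim (cvg_cst _)).
near=> y.
have xy : x <= y by near: y; apply: nbhs_pinfty_ge; exact: num_real.
apply: (@le_trans _ _ ((p + c \*: F) y)).
  by rewrite /= lerDr ltW.
rewrite -lerN2.
have dN t := is_deriveN (dpF c t).
apply: (ge0_derive_le xy dN) => t xt ty.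
rewrite -mulNr mulr_ge0 ?(ltW (p_gt0 _))//.
have := le_min (ltW xt); rewrite /c; lra.
Unshelve. all: by end_near. Qed.

(** The mirror image: with [c = nu x], the function [p - c F] is nondecreasing to
    the left of [x]. *)
Lemma mills_left (x : R) : x <= 0 -> nu x * F x <= p x.
Proof.
move=> x0; set c := nu x.
have c0 : 0 <= c by rewrite /c; case: (leP x z) z_gt0; lra.
suff : 0 - c * 0 <= p x - c * F x by lra.
have lim : - (c * F y) @[y --> -oo] --> - (c * 0).
  by apply: cvgN; apply: cvgMl_tmp.
rewrite sub0r.
apply: (ler_cvg_to lim (cvg_cst _)).
near=> y.
have yx : y <= x by near: y; apply: nbhs_ninfty_le; exact: num_real.
apply: (@le_trans _ _ ((p + (- c) \*: F) y)).
  by rewrite -mulNr -[leRHS]/(p y + - c * F y) lerDr ltW.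
have -> : p x - c * F x = (p + (- c) \*: F) x by rewrite -mulNr.
apply: (ge0_derive_le yx (dpF (- c))) => t yt tx.
rewrite mulr_ge0 ?(ltW (p_gt0 _))//.
have := le_min (ltW tx); rewrite /c; lra.
Unshelve. all: by end_near. Qed.

Lemma density_le_mode (x : R) : p x <= p 0.
Proof.
case: (leP x 0) => x0.
  apply: (ge0_derive_le x0 dp) => t _ t0.
  by rewrite mulr_ge0 ?(ltW (p_gt0 _))//; case: (leP t z) z_gt0; lra.
rewrite -lerN2; have dN t := is_deriveN (dp t).
apply: (ge0_derive_le (ltW x0) dN) => t t0 _.
by rewrite -mulNr mulr_ge0 ?(ltW (p_gt0 _))//; case: (leP t z) z_gt0; lra.
Qed.

(** On this range [|p'| = |nu| p <= p 0 / 2], so [p] loses at most [p 0 / 4]. *)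
Lemma density_near_mode (x : R) : - (1 / 2) <= x -> x <= 1 / 2 -> 3 / 4 * p 0 <= p x.
Proof.
move=> xl xr.
have slope c : `|c| <= 1 / 2 -> `|nu c * p c| <= 1 / 2 * p 0.
  move=> c2; rewrite normrM (gtr0_norm (p_gt0 c)).
  apply: ler_pM => //; [exact: ltW|rewrite normrN|exact: density_le_mode].
  by move: c2; rewrite !ler_norml => /andP[]; case: (leP c z) z_gt0; lra.
have [x0|x0|->] := ltgtP x 0; last by have := p_gt0 0; lra.
- have [c [xc c0]] := mean_value x0 dp.
  have /slope : `|c| <= 1 / 2 by rewrite ler_norml; lra.
  move: (_ * p c) (p_gt0 0) => s p00; rewrite ler_norml => /andP[_ s2] H.
  nra.
- have [c [xc c0]] := mean_value x0 dp.
  have /slope : `|c| <= 1 / 2 by rewrite ler_norml; lra.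
  move: (_ * p c) (p_gt0 0) => s p00; rewrite ler_norml => /andP[s2 _] H.
  nra.
Qed.

(** The part of the mass to the left of [- 1 / 2] is at most [2 p (- 1 / 2)] since
    the drift there is [1 / 2], and the remaining interval has length [1]. *)
Lemma cdf_near_mode (x : R) : x <= 1 / 2 -> F x <= 3 * p 0.
Proof.
move=> xr.
have mono : F x <= F (1 / 2) by apply: (ge0_derive_le xr dF) => t _ _; exact: ltW.
apply: (le_trans mono).
have /mean_value/(_ dF)[c [_ _ H]] : - (1 / 2) < 1 / 2 :> R by lra.
have /mills_left : - (1 / 2) <= 0 :> R by lra.
rewrite min_l; last by have := z_gt0; lra.
have := density_le_mode c; have := density_le_mode (- (1 / 2)).
lra.
Qed.

(** The solutions of the Stein equation below are quotients [g / p] whose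
    numerator is at most [F] and at most [1 - F]. *)
Section bounds.
Context (x g : R).
Hypotheses (g0 : 0 <= g) (gF : g <= F x) (gF1 : g <= 1 - F x).

Lemma stein_drift_bound : `|nu x| * g <= p x.
Proof.
have [x0|x0] := leP x 0.
  rewrite ger0_norm; last by case: (leP x z) z_gt0; lra.
  apply: le_trans (mills_left x0); rewrite ler_wpM2l//.
  by case: (leP x z) z_gt0; lra.
rewrite ler0_norm; last by case: (leP x z) z_gt0; lra.
apply: le_trans (mills_right (ltW x0)); rewrite ler_wpM2l//.
by case: (leP x z) z_gt0; lra.
Qed.

(** Far from [0] the drift [- x] is at least [1 / 2] in size and the previous
    bound applies; near [0] the density is comparable with its maximum. To the
    right of [z] no such bound holds uniformly in [z]: [(1 - F) / p] is [1 / z]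
    there. *)
Lemma stein_bound : x <= z -> g <= 4 * p x.
Proof.
move=> xz; have px := p_gt0 x.
have [xs|xs] := leP `|x| (1 / 2).
  move: xs; rewrite ler_norml => /andP[xl xr].
  have := density_near_mode xl xr; have := cdf_near_mode xr; have := gF; lra.
have := stein_drift_bound; rewrite min_l// normrN.
have := ler_wpM2r g0 (ltW xs); lra.
Qed.

End bounds.

(** One solution [f = G / p] of the Stein equation [f' + nu f = c] on a side of
    the jump of the indicator, where the right-hand side is a constant [c]. *)
Section step.
Context (G : R -> R) (c u v : R).
Hypothesis c_le1 : `|c| <= 1.
Hypothesis dG : forall x : R, is_derive x 1 G (c * p x).
Hypothesis uv : u < v.
Hypothesis GF : forall x : R, u <= x <= v ->
  [/\ 0 <= G x, G x <= F x & G x <= 1 - F x].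
Local Notation f x := (G x / p x).

Lemma stein_derive (x : R) : is_derive x 1 (fun y => f y) (c - nu x * f x).
Proof.
have px := lt0r_neq0 (p_gt0 x).
have dpV : is_derive x 1 (fun y => (p y)^-1) (- (p x) ^- 2 *: (nu x * p x)).
  apply: DeriveDef; first exact: derivableV.
  by rewrite deriveV// derive_val.
apply: is_derive_eq; rewrite /= /GRing.scale/=; field.
exact: px.
Qed.

Let drift_f (x : R) : u <= x <= v -> `|nu x * f x| <= 1.
Proof.
move=> /GF[g0 gF gF1].
rewrite normrM normf_div (gtr0_norm (p_gt0 x)) (ger0_norm g0) mulrA.
by rewrite ler_pdivrMr// mul1r stein_drift_bound.
Qed.

Let f_lipschitz (w : R) : u <= w <= v -> `|f w - f u| <= 2 * (w - u).
Proof.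
move=> /andP[]; rewrite le_eqVlt => /predU1P[<-|uw wv].
  by rewrite !subrr normr0 mulr0.
have [x [ux xw ->]] := mean_value uw stein_derive.
rewrite normrM (gtr0_norm (_ : 0 < w - u)) ?subr_gt0// ler_wpM2r//.
  by rewrite subr_ge0 ltW.
have fx1 : `|nu x * f x| <= 1.
  by apply: drift_f; rewrite (ltW ux) (le_trans (ltW xw) wv).
by apply: le_trans (ler_normB _ _) _; rewrite -[2]/(1 + 1) lerD.
Qed.

(** By the mean value theorem the difference is [nu u * f u - nu x * f x] for some
    [x] between [u] and [v], which is [(nu u - nu x) * f x - nu u * (f x - f u)].
    The first product is small since [nu] has slope [-1] left of [z], where [f]
    is at most [4], and slope [0] right of [z]; the second since [|f'| <= 2]. *)
Lemma stein_step : v <= z \/ z <= u ->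
  `|(f v - f u) / (v - u) + nu u * f u - c| <= (v - u) * (4 + 2 * `|nu u|).
Proof.
move=> kink.
have [x [ux xv ->]] := mean_value uv stein_derive.
rewrite mulfK; last by rewrite subr_eq0 gt_eqF.
have -> : c - nu x * f x + nu u * f u - c
    = (nu u - nu x) * f x - nu u * (f x - f u) by ring.
apply: le_trans (ler_normB _ _) _.
rewrite !normrM mulrDr; apply: lerD.
  have xuv : u <= x <= v by rewrite !ltW.
  case: kink => [vz|zu]; last first.
    rewrite !min_r ?(le_trans zu (ltW ux))// subrr normr0 mul0r.
    by rewrite mulr_ge0// subr_ge0 ltW.
  have xz := le_trans (ltW xv) vz.
  rewrite !min_l ?(le_trans (ltW ux) xz)//.
  have [g0 gF gF1] := GF xuv.
  rewrite normfV (gtr0_norm (p_gt0 x)) (ger0_norm g0).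
  apply: ler_pM; rewrite ?divr_ge0 ?(ltW (p_gt0 x))//.
    by rewrite ger0_norm; lra.
  by rewrite ler_pdivrMr// stein_bound.
rewrite mulrC mulrA; apply: ler_wpM2r => //.
rewrite [leRHS]mulrC; apply: le_trans (f_lipschitz _) _; first by rewrite !ltW.
by rewrite ler_wpM2l// lerD2r ltW.
Qed.

End step.
End stein.

(** * Comparison of the distribution functions *)

Section grid.
Context (R : realType) (n : nat) (r dl : R) (a : nat -> R) (F p : R -> R).
Local Notation z := (dl * (n%:R - r)).
Local Notation nu x := (- Num.min x z).
Local Notation pt k := (dl * (k%:R - r)).
Hypothesis r_gt0 : 0 < r.
Hypothesis r_ltn : r < n%:R.
Hypothesis dl_gt0 : 0 < dl.
Hypothesis dl_sq : dl ^+ 2 * r = 1.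
Hypothesis a_ge0 : forall k, 0 <= a k.
Hypothesis a_balance : forall k, r * a k = (minn k.+1 n)%:R * a k.+1.
Hypothesis a_sum1 : (\sum_(0 <= k <oo) (a k)%:E = 1)%E.
Hypothesis p_gt0 : forall x, 0 < p x.
Hypothesis dF : forall x : R, is_derive x 1 F (p x).
Hypothesis dp : forall x : R, is_derive x 1 p (nu x * p x).
Hypothesis F_ge0 : forall x, 0 <= F x.
Hypothesis F_le1 : forall x, F x <= 1.
Hypothesis F_pinfty : F x @[x --> +oo] --> (1 : R).
Hypothesis F_ninfty : F x @[x --> -oo] --> (0 : R).

Let z_gt0 : 0 < z.
Proof. by rewrite mulr_gt0// subr_gt0. Qed.

Let a_psum K : \sum_(k < K) a k <= 1.
Proof. exact: psum_le_nneseries. Qed.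

Let F_mono (x y : R) : x <= y -> F x <= F y.
Proof. by move=> xy; apply: (ge0_derive_le xy dF) => t _ _; exact: ltW. Qed.

Let nu_pt k : nu (pt k) = dl * (r - (minn k n)%:R).
Proof. by rewrite -(minr_pMr _ _ (ltW dl_gt0)) -addr_minl -natr_min; ring. Qed.

Let pt_step k : pt k.+1 - pt k = dl.
Proof. by rewrite -natr1; ring. Qed.

Let pt_le k l : (k <= l)%N -> pt k <= pt l.
Proof. by move=> kl; rewrite (ler_wpM2l (ltW dl_gt0))// lerD2r ler_nat. Qed.

(* The kink of the drift sits at the grid point of index [n]. *)
Let no_kink k : pt k.+1 <= z \/ z <= pt k.
Proof. by have [kn|nk] := ltnP k n; [left|right]; exact: pt_le. Qed.

(** The generator of the chain, applied to [G / p] on the grid, is nearly the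
    Stein operator of the diffusion: [dl * (r * f' - s * f)] is
    [(f' - f) / dl + dl * (r - s) * f] because [dl ^+ 2 * r = 1]. *)
Let generator_step (G : R -> R) (c : R) k : `|c| <= 1 ->
  (forall x : R, is_derive x 1 G (c * p x)) ->
  (forall x : R, pt k <= x <= pt k.+1 ->
     [/\ 0 <= G x, G x <= F x & G x <= 1 - F x]) ->
  `|dl * (r * (G (pt k.+1) / p (pt k.+1))
          - (minn k n)%:R * (G (pt k) / p (pt k))) - c|
  <= dl * (4 + 2 * `|dl * (r - (minn k n)%:R)|).
Proof.
move=> c1 dG GF.
have lt_pt : pt k < pt k.+1 by rewrite -subr_gt0 pt_step.
have := stein_step z_gt0 p_gt0 dF dp F_pinfty F_ninfty c1 dG lt_pt GF (no_kink k).
rewrite pt_step nu_pt; move: (_ / p _) (_ / p _) => g g'.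
congr (`|_| <= _); congr (_ - _).
have -> : dl^-1 = dl * r.
  by apply: (mulfI (lt0r_neq0 dl_gt0)); rewrite mulfV ?lt0r_neq0// mulrA -expr2.
ring.
Qed.

(** With [A = F (pt m)], the Stein equation for the indicator of [x <= pt m] is
    solved by [(1 - A) * F / p] on the left of [pt m] and by [A * (1 - F) / p]
    on the right. Averaging the generator over [a] gives [0] up to a boundary
    term that vanishes as [K] grows, whereas each term is [(k < m) - A] up to the
    error of [generator_step], whose mean is at most [6 * dl]. *)
Lemma grid_bound m : `|\sum_(k < m) a k - F (pt m)| <= 6 * dl.
Proof.
set A := F (pt m).
have A0 : 0 <= A := F_ge0 _.
have A1 : A <= 1 := F_le1 _.
pose f k :=
  (if (k <= m)%N then (1 - A) * F (pt k) else A * (1 - F (pt k))) / p (pt k).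
pose D k := dl * (r * f k.+1 - (minn k n)%:R * f k).
have step k : `|D k - ((k < m)%:R - A)| <=
    dl * (4 + 2 * `|dl * (r - (minn k n)%:R)|).
  rewrite /D /f; have [km|mk] := ltnP k m.
    rewrite (ltnW km) mulr1n; apply: (@generator_step (fun x => (1 - A) * F x)).
    - rewrite ger0_norm; lra.
    - move=> x /andP[_ xk].
      have : F x <= A by apply: F_mono; apply: le_trans xk _; exact: pt_le.
      by have := F_ge0 x; split; nra.
  (* Both formulas for the solution agree at [pt m]. *)
  have -> : (if (k <= m)%N then (1 - A) * F (pt k) else A * (1 - F (pt k)))
      = A * (1 - F (pt k)).
    case: ifPn => // km; rewrite (_ : k = m); first by rewrite -/A mulrC.
    by apply/eqP; rewrite eqn_leq km.
  rewrite mulr0n sub0r; apply: (@generator_step (fun x => A * (1 - F x))).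
  - by rewrite normrN ger0_norm.
  - move=> x.
    have dN : is_derive x 1 (A \*: (cst 1 - F)) (A *: (0 - p x)).
      by apply: is_deriveZ; apply: is_deriveB.
    by apply: is_derive_eq; rewrite sub0r scalerN -mulNr.
  - move=> x /andP[kx _].
    have : A <= F x by apply: F_mono; apply: le_trans kx; exact: pt_le.
    by have := F_le1 x; split; nra.
have tail K : (n <= K)%N -> (m < K)%N ->
    `|\sum_(k < m) a k - A * \sum_(k < K) a k| <= 6 * dl + dl * n%:R / z * a K.
  move=> nK mK.
  have telescope : \sum_(k < K) a k * D k = dl * (n%:R * a K * f K).
    rewrite -{1}(minn_idPr nK) -(stein_identity a_balance) mulr_sumr.
    by apply: eq_bigr => k _; rewrite mulrCA.
  have split_sum : \sum_(k < m) a k - A * \sum_(k < K) a k =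
      dl * (n%:R * a K * f K) - \sum_(k < K) a k * (D k - ((k < m)%:R - A)).
    rewrite -telescope -sumrB.
    under [RHS]eq_bigr do rewrite mulrBr opprB addrC subrK mulrBr.
    rewrite sumrB -mulr_suml [A * _]mulrC; congr (_ - _).
    rewrite (big_ord_widen K a (ltnW mK)).
    rewrite [RHS](bigID (fun k : 'I_K => (k < m)%N))/=.
    rewrite [X in _ = _ + X]big1 ?addr0; last by move=> k /negPf ->; rewrite mulr0.
    by apply: eq_bigr => k ->; rewrite mulr1.
  rewrite split_sum; apply: le_trans (ler_normB _ _) _; rewrite addrC; apply: lerD.
    apply: le_trans (ler_norm_sum _ _ _) _.
    apply: (@le_trans _ _ (\sum_(k < K) (4 * dl * a k
        + 2 * dl * (a k * `|dl * (r - (minn k n)%:R)|)))).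
      apply: ler_sum => k _; rewrite normrM ger0_norm//.
      by apply: le_trans (ler_wpM2l (a_ge0 k) (step k)) _; lra.
    rewrite big_split/= -!mulr_sumr.
    have := ler_wpM2l (ltW dl_gt0) (a_psum K).
    have := ler_wpM2l (ltW dl_gt0)
      (mean_abs_imbalance a_ge0 a_balance r_gt0 r_ltn a_psum dl_sq K).
    lra.
  have f0 : 0 <= f K.
    rewrite /f divr_ge0 ?(ltW (p_gt0 _))//.
    by case: ifP => _; rewrite mulr_ge0// subr_ge0.
  (* Beyond the grid point of index [n] the drift is [- z]. *)
  have fz : f K <= z^-1.
    rewrite /f leqNgt mK/= ler_pdivrMr// [leRHS]mulrC ler_pdivlMr// mulrC.
    have zK : z <= pt K by exact: pt_le.
    have AK : A <= F (pt K) by apply: F_mono; apply: pt_le; exact: ltnW.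
    have := @stein_drift_bound _ _ _ _ z_gt0 p_gt0 dF dp F_pinfty F_ninfty
      (pt K) (A * (1 - F (pt K))).
    rewrite min_r// normrN (gtr0_norm z_gt0); apply.
    - by have := F_le1 (pt K); nra.
    - by have := F_le1 (pt K); nra.
  rewrite ger0_norm; last first.
    by apply: mulr_ge0; [exact: ltW|do 2!apply: mulr_ge0 => //].
  have := ler_wpM2l (mulr_ge0 (mulr_ge0 (ltW dl_gt0) (ler0n _ n)) (a_ge0 K)) fz.
  lra.
have cvg_a := cvg_psum a_ge0 a_sum1.
have a0 : a K @[K --> \oo] --> (0 : R).
  have -> : a = (fun K => \sum_(k < K.+1) a k - \sum_(k < K) a k).
    by apply/funext => K; rewrite big_ord_recr/= addrAC subrr add0r.
  rewrite -[X in _ --> X](subrr (1 : R)); apply: cvgB => //.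
  by move: cvg_a; rewrite -cvg_shiftS.
have lhs : `|\sum_(k < m) a k - A * \sum_(k < K) a k| @[K --> \oo]
    --> `|\sum_(k < m) a k - A * 1|.
  by apply: cvg_norm; apply: cvgB; [exact: cvg_cst|exact: cvgMl_tmp].
have rhs : 6 * dl + dl * n%:R / z * a K @[K --> \oo]
    --> 6 * dl + dl * n%:R / z * 0.
  by apply: cvgD; [exact: cvg_cst|exact: cvgMl_tmp].
rewrite mulr1 in lhs; rewrite mulr0 addr0 in rhs.
apply: (ler_cvg_to lhs rhs); near=> K; apply: tail; near: K.
  exact: nbhs_infty_ge.
exact: nbhs_infty_gt.
Unshelve. all: by end_near. Qed.

(** The cdf of the chain is constant between two grid points, with a jump of at
    most [dl] at the left one, and [F] is monotone. *)
Lemma between_grid_bound m (x : R) : pt m <= x -> x <= pt m.+1 ->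
  `|\sum_(k < m.+1) a k - F x| <= 7 * dl.
Proof.
move=> mx xm.
have := grid_bound m; have := grid_bound m.+1.
have := F_mono mx; have := F_mono xm.
have := mass_le_delta a_ge0 a_balance r_gt0 r_ltn a_psum dl_gt0 dl_sq m.
have := a_ge0 m; have := dl_gt0.
rewrite big_ord_recr/= !ler_norml => ? ? ? ? ? /andP[? ?] /andP[? ?].
by apply/andP; split; lra.
Qed.

Lemma below_grid_bound (x : R) : x <= pt 0 -> `|0 - F x| <= 7 * dl.
Proof.
move=> /F_mono; have := grid_bound 0; rewrite big_ord0 !sub0r !normrN.
rewrite !ger0_norm//; have := dl_gt0; lra.
Qed.

End grid.

(** * The density of the diffusion *)

Section density.
Context (R : realType).
Local Notation leb := (@lebesgue_measure R).

Let continuous_integrable (g : R -> R) (a b : R) : continuous g ->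
  leb.-integrable `[a, b] (EFin \o g).
Proof.
move=> cg; apply: continuous_compact_integrable; first exact: segment_compact.
exact: continuous_subspaceT.
Qed.

(** A base point [- M] to the left of both [0] and [y] removes the case distinction
    in the oriented integral. *)
Lemma integral_from0E (g : R -> R) (M y : R) : continuous g ->
  - M <= 0 -> - M <= y ->
  integral_from0 g y =
    \int[leb]_(t in `[- M, y]) g t - \int[leb]_(t in `[- M, 0]) g t.
Proof.
move=> cg M0 My; rewrite /integral_from0; case: (leP 0 y) => y0.
  rewrite Rintegral_itvB ?bnd_simp//; last exact: continuous_integrable.
  rewrite Rintegral_itv_obnd_cbnd//.
  apply: integrableS (continuous_integrable 0 y cg) => //.
  by apply: subset_itvr; rewrite bnd_simp.
rewrite -opprB Rintegral_itvB ?bnd_simp ?(ltW y0)//; last first.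
  exact: continuous_integrable.
rewrite Rintegral_itv_obnd_cbnd//.
apply: integrableS (continuous_integrable y 0 cg) => //.
by apply: subset_itvr; rewrite bnd_simp.
Qed.

Lemma is_derive_integral_from0 (g : R -> R) (x : R) : continuous g ->
  is_derive x 1 (integral_from0 g) (g x).
Proof.
move=> cg; pose M : R := `|x| + 1.
have xM : - M < x by rewrite /M; have := ler_norm (- x); rewrite normrN; lra.
have M0 : - M <= 0 by rewrite /M; have := normr_ge0 x; lra.
have xM1 : x < M by rewrite /M; have := ler_norm x; lra.
have [dG dGE] :=
  continuous_FTC1_closed xM1 (continuous_integrable (- M) M cg) xM (cg x).
set c := \int[leb]_(t in `[- M, 0]) g t.
rewrite derive1E in dGE; have dG' := DeriveDef dG dGE.
have dH : is_derive x 1 ((fun y => \int[leb]_(t in `[- M, y]) g t) - cst c) (g x).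
  by apply: is_derive_eq; rewrite subr0.
apply: near_eq_is_derive dH.
near=> y; apply/esym/integral_from0E => //.
by near: y; apply: (cvgr_ge x) => //; exact: cvg_id.
Unshelve. all: by end_near. Qed.

Lemma derivable_continuous (f df : R -> R) :
  (forall x : R, is_derive x 1 f (df x)) -> continuous f.
Proof.
move=> dfx x; apply: differentiable_continuous; apply/derivable1_diffP.
exact: ex_derive.
Qed.

End density.

Section law_with_density.
Context (R : realType) d (T : measurableType d) (P : probability T R).
Context (Y : {RV P >-> R}) (f : R -> R).
Hypothesis Yf : has_density Y f.
Hypothesis f_continuous : continuous f.
Hypothesis f_ge0 : forall x, 0 <= f x.

Lemma is_derive_cdf (x : R) : is_derive x 1 (fine \o cdf Y) (f x).
Proof.
have int y : lebesgue_measure.-integrable `]-oo, y] (EFin \o f).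
  apply/integrableP; split.
    apply/measurable_EFinP; apply: measurable_funTS.
    exact: continuous_measurable_fun.
  under eq_integral do rewrite /= ger0_norm//.
  by rewrite -Yf// (le_lt_trans (probability_le1 _ _))// ltry.
have x1 : x < x + 1 by rewrite ltrDl.
have [df dfE] := continuous_FTC1 x1 (int _) (ltNyr x) (@f_continuous x).
have -> : fine \o cdf Y = fun y => \int[lebesgue_measure]_(t in `]-oo, y]) f t.
  by apply/funext => y; rewrite /= /cdf Yf.
by rewrite derive1E in dfE; exact: DeriveDef.
Qed.
End law_with_density.

Section diffusion.
Context (R : realType) (n : nat) (lambda mu kappa : R).
Hypothesis mu_gt0 : 0 < mu.
Hypothesis load_gt0 : 0 < load lambda mu.
Hypothesis load_lt_n : load lambda mu < n%:R.
Hypothesis kappa_gt0 : 0 < kappa.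
Local Notation dl := (delta lambda mu).
Local Notation r := (load lambda mu).
Local Notation z := (dl * (n%:R - r)).

Lemma delta_gt0 : 0 < dl.
Proof. by rewrite divr_gt0// sqrtr_gt0. Qed.

Lemma delta_sq : dl ^+ 2 * r = 1.
Proof. by rewrite /delta div1r exprVn sqr_sqrtr ?ltW// mulVf// lt0r_neq0. Qed.

(** As [zeta] is negative, the drift is linear with slope [- mu] up to the point
    [z = - zeta] and constant from there on. *)
Lemma driftE x : drift n lambda mu x = - Num.min x z * mu.
Proof.
have z0 : 0 < z by rewrite mulr_gt0 ?delta_gt0// subr_gt0.
have zE : zeta n lambda mu = - z by rewrite /zeta; ring.
rewrite /drift /neg_part zE opprK (max_l (ltW z0)); congr (_ * _).
by case: (leP x z) => xz; [rewrite max_l|rewrite max_r]; lra.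
Qed.

Lemma drift_continuous : continuous (drift n lambda mu).
Proof.
have -> : drift n lambda mu = fun x => - Num.min x z * mu by apply/funext/driftE.
move=> x; apply: cvgMr_tmp; apply: cvgN.
suff : {for x, continuous ((id : R -> R) \min cst z)} by [].
by apply: continuous_min => //; exact: cst_continuous.
Qed.

Local Notation f := (diffusion_density n lambda mu kappa).

Lemma diffusion_density_gt0 x : 0 < f x.
Proof. by rewrite mulr_gt0// expR_gt0. Qed.

Lemma is_derive_diffusion_density (x : R) : is_derive x 1 f (- Num.min x z * f x).
Proof.
have dI := is_derive_integral_from0 x drift_continuous.
have fE : f =
    kappa \*: (expR \o (mu^-1 \*: integral_from0 (drift n lambda mu))).
  by apply/funext => y; rewrite /diffusion_density div1r.
rewrite [X in is_derive _ _ X]fE; apply: is_derive_eq.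
rewrite /= /diffusion_density /GRing.scale/= driftE div1r.
by field; rewrite lt0r_neq0.
Qed.
End diffusion.

(** * The Kolmogorov distance *)

Unset Implicit Arguments.

Theorem theorem2p2 (R : realType) (n : nat) (lambda mu : R)
  (p : R -> nat -> nat -> R)
  (d : measure_display) (T : measurableType d) (P : probability T R)
  (X : {RV P >-> nat})
  (d' : measure_display) (T' : measurableType d') (P' : probability T' R)
  (Y : {RV P' >-> R}) (kappa : R)
  (n_ge1 : (1 <= n)%N) (lambda_gt0 : 0 < lambda) (mu_gt0 : 0 < mu)
  (load_ge1 : 1 <= load lambda mu) (load_lt_n : load lambda mu < n%:R)
  (p_erlangC : erlangC_transition n lambda mu p)
  (X_stationary : stationary_distribution p (distribution P X))
  (kappa_gt0 : 0 < kappa)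
  (Y_density : has_density Y (diffusion_density n lambda mu kappa)) :
  (kolmogorov_distance (scaled lambda mu X : {RV P >-> R}) Y
     <= (156 * delta lambda mu)%:E)%E.
Proof.
have load_gt0 : 0 < load lambda mu := lt_le_trans ltr01 load_ge1.
pose a k := fine (distribution P X [set k]).
set F := fine \o cdf Y.
set r := load lambda mu in load_gt0 load_lt_n *.
set dl := delta lambda mu.
have dl_gt0 : 0 < dl := delta_gt0 load_gt0.
have f_gt0 := diffusion_density_gt0 n lambda mu kappa_gt0.
have df := is_derive_diffusion_density kappa mu_gt0 load_gt0 load_lt_n.
have dF x := is_derive_cdf Y_density (derivable_continuous df)
  (fun x => ltW (f_gt0 x)) x.
have FE x : cdf Y x = (F x)%:E.
  by rewrite fineK// fin_num_measure.
have F_ge0 x : 0 <= F x by exact: fine_ge0.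
have F_le1 x : F x <= 1 by rewrite -lee_fin -FE cdf_le1.
have Fy : F x @[x --> +oo] --> (1 : R) by apply: fine_cvg; exact: cvg_cdfy1.
have FNy : F x @[x --> -oo] --> (0 : R) by apply: fine_cvg; exact: cvg_cdfNy0.
have a_ge0 k : 0 <= a k by exact: fine_ge0.
have a_bal k :=
  erlangC_stationary_balance k lambda_gt0 mu_gt0 p_erlangC X_stationary.
have a_sum1 := mass_series (distribution P X).
have cdfX x : cdf (scaled lambda mu X : {RV P >-> R}) x
    = distribution P X [set k | dl * (k%:R - r) <= x].
  by [].
apply: ge_ereal_sup => _ [x _ <-].
have le7 : 7 * dl <= 156 * dl by rewrite (ler_wpM2r (ltW dl_gt0))// ler_nat.
rewrite cdfX FE; have [x0|x0] := ltP x (dl * (0%:R - r)).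
  rewrite (_ : [set k | _] = set0); last first.
    apply/seteqP; split => // k /= kx.
    have : dl * (0%:R - r) <= dl * (k%:R - r).
      by rewrite (ler_wpM2l (ltW dl_gt0))// lerD2r ler_nat.
    by move=> /le_trans /(_ kx); rewrite leNgt x0.
  rewrite measure0 -EFinB/= lee_fin; apply: le_trans le7.
  exact: (below_grid_bound load_gt0 load_lt_n dl_gt0 (delta_sq load_gt0)
    a_ge0 a_bal a_sum1 f_gt0 dF df F_ge0 F_le1 Fy FNy (ltW x0)).
(* [m] is the index of the last grid point not to the right of [x]. *)
have y0 : 0 <= x / dl + r.
  by rewrite -lerBlDr ler_pdivlMr// mulrC.
pose m := Num.truncn (x / dl + r).
have /andP[mx xm] := truncn_itv y0.
rewrite (_ : [set k | _] = [set k | (k < m.+1)%N]); last first.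
  have kE k : (dl * (k%:R - r) <= x) = (k%:R <= x / dl + r).
    by rewrite -lerBlDr ler_pdivlMr// mulrC.
  apply/seteqP; split => k /=; rewrite kE.
    by move=> /le_lt_trans/(_ xm); rewrite ltr_nat.
  by rewrite ltnS => km; apply: le_trans mx; rewrite ler_nat.
rewrite mass_below -EFinB/= lee_fin; apply: le_trans le7.
apply: (between_grid_bound load_gt0 load_lt_n dl_gt0 (delta_sq load_gt0)
  a_ge0 a_bal a_sum1 f_gt0 dF df F_ge0 F_le1 Fy FNy).
  by rewrite mulrC -ler_pdivlMr// lerBlDr.
by rewrite mulrC -ler_pdivrMr// lerBrDr ltW.
Qed.
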